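(* Let $R$ be a ring with identity, let $\mathcal{S}$ be a class of finitely presented left $R$-modules, and let $\mathbf{E}=0\to A\overset{i}{\hookrightarrow}B\overset{\psi}{\to}C\to 0$ be an exact sequence of left $R$-modules, where $A$ is a submodule of $B$ and $i$ is the inclusion. The following are equivalent: (i) $\mathbf{E}$ is $\mathcal{S}$-pure exact. (ii) $\mathrm{tr}(U)\otimes_R\mathbf{E}$ is exact for all $U\in\mathcal{S}$. (iii) $\mu(A^k)=A^n\cap\mu(B^k)$ for all natural numbers $k,n$ and all matrices $\mu\in\mathrm{Hom}_R(R^k,R^n)$ such that $\mathrm{Coker}\,\mu^t$ is isomorphic to a member of $\mathcal{S}$. (iv) For all natural numbers $k,n$, any matrix $(r_{ij})\in\mathrm{Hom}_R(R^n,R^k)$ such that $\mathrm{Coker}(r_{ij})$ is isomorphic to a member of $\mathcal{S}$, and any $a_1,\dots,a_n\in A$: if the system of linear equations $\sum_{i=1}^k r_{ij}x_i=a_j$, $1\le j\le n$, is soluble in $B$, then it is also soluble in $A$.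
   Context: All rings have an identity (not necessarily commutative) and $R$-module means unitary left $R$-module. A short exact sequence $0\to A\to B\to C\to 0$ of $R$-modules is $\mathcal{S}$-pure exact if for all $U\in\mathcal{S}$ the induced map $\mathrm{Hom}_R(U,B)\to\mathrm{Hom}_R(U,C)$ is surjective. Matrix conventions. In (iv), $(r_{ij})$ ($1\le i\le k$, $1\le j\le n$) is the homomorphism of left modules $R^n\to R^k$ sending the $j$-th standard basis vector to $(r_{1j},\dots,r_{kj})$, so $\mathrm{Coker}(r_{ij})$ is the left $R$-module with generators $u_1,\dots,u_k$ and relations $\sum_{i=1}^k r_{ij}u_i=0$, $1\le j\le n$. In (iii), $\mu=(r_{ji})$ ($1\le j\le n$, $1\le i\le k$) acts on a left $R$-module $X$ as the additive map $X^k\to X^n$, $(x_1,\dots,x_k)\mapsto(\sum_{i=1}^k r_{ji}x_i)_{1\le j\le n}$, and $\mu^t:R^n\to R^k$ is the homomorphism of left modules sending the $j$-th basis vector to $(r_{j1},\dots,r_{jk})$, so $\mathrm{Coker}\,\mu^t$ is the left module with generators $u_1,\dots,u_k$ and relations $\sum_{i=1}^k r_{ji}u_i=0$, $1\le j\le n$. The intersection $A^n\cap\mu(B^k)$ is taken in $B^n$. Auslander transpose: given a finite presentation of a finitely presented left $R$-module $U$ with generators $u_1,\dots,u_k$ and relations $\sum_{i=1}^k r_{ji}u_i=0$, $1\le j\le n$, $\mathrm{tr}(U)$ is the right $R$-module which is the cokernel of the homomorphism of right $R$-modules $R^k\to R^n$ given by left multiplication of column vectors by the $n\times k$ matrix $(r_{ji})$.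 It is unique up to projective direct summands, and the validity of (ii) does not depend on the choice of presentation. *)

(* Defs.v *)
From HB Require Import structures.
From mathcomp Require Import all_boot all_order all_algebra.
From mathcomp Require Import boolp classical_sets.
From mathcomp.multinomials Require Import freeg.

Set Implicit Arguments.
Unset Strict Implicit.
Unset Printing Implicit Defensive.

Import GRing.Theory.
Local Open Scope ring_scope.
Local Open Scope quotient_scope.

(* Rings are [pzRingType]s, so the zero ring is allowed.  Left R-modules are
   [lmodType R]; right R-modules are left modules over the converse ring,
   [lmodType R^c], i.e. [m r] is written [(r : R^c) *: m]. *)

Definition short_exact (A B C : zmodType) (f : A -> B) (g : B -> C) : Prop :=
  [/\ injective f,
      forall b, g b = 0 <-> exists a, f a = b
    & forall c, exists b, g b = c].

Definition lmod_iso (R : pzRingType) (U V : lmodType R) : Prop :=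
  exists f : {linear U -> V}, bijective f.

Definition iso_to_member (R : pzRingType) (S : lmodType R -> Prop)
    (U : lmodType R) : Prop :=
  exists2 V, S V & lmod_iso U V.

Definition pure_exact (R : pzRingType) (S : lmodType R -> Prop)
    (A B C : lmodType R) (i : {linear A -> B}) (psi : {linear B -> C}) : Prop :=
  short_exact i psi /\
  forall U, S U -> forall g : {linear U -> C},
    exists h : {linear U -> B}, forall u, psi (h u) = g u.

Definition inclusion (R : pzRingType) (B : lmodType R) (inA : {pred B})
    (A : subLmodType inA) : {linear A -> B} := val.

Section Coker.
Variables (R : pzRingType) (M N : lmodType R) (f : {linear M -> N}).

Definition im_pred : {pred N} := fun y => `[< exists x, f x = y >].

Lemma im_predP y : reflect (exists x, f x = y) (y \in im_pred).
Proof. exact: asboolP. Qed.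

Lemma im_pred_zmod_closed : zmod_closed im_pred.
Proof.
split; first by apply/im_predP; exists 0; rewrite linear0.
move=> _ _ /im_predP[x <-] /im_predP[y <-].
by apply/im_predP; exists (x - y); rewrite linearB.
Qed.

HB.instance Definition _ :=
  GRing.isZmodClosed.Build N im_pred im_pred_zmod_closed.

Definition coker : Type := Quotient.quot im_pred.

HB.instance Definition _ := Choice.on coker.
HB.instance Definition _ := GRing.Zmodule.on coker.

Definition coker_pi (y : N) : coker := \pi_(Quotient.quot im_pred) y.
Definition coker_repr (q : coker) : N := repr (q : Quotient.quot im_pred).

Lemma coker_reprK q : coker_pi (coker_repr q) = q.
Proof. exact: reprK. Qed.

Lemma coker_pi_eq y z : coker_pi y = coker_pi z <-> exists x, f x = y - z.
Proof.
split=> [/eqP|/asboolP yz].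
  by rewrite -(Quotient.idealrBE im_pred) => /asboolP.
by apply/eqP; rewrite -(Quotient.idealrBE im_pred).
Qed.

Lemma coker_piD y z : coker_pi (y + z) = coker_pi y + coker_pi z.
Proof. exact: raddfD. Qed.

Definition coker_scale (a : R) (q : coker) : coker :=
  coker_pi (a *: coker_repr q).

Lemma coker_pi_scale a y : coker_scale a (coker_pi y) = coker_pi (a *: y).
Proof.
apply/coker_pi_eq; have /coker_pi_eq[x fx] := coker_reprK (coker_pi y).
by exists (a *: x); rewrite linearZ_LR fx scalerBr.
Qed.

Fact coker_scaleA a b q : coker_scale a (coker_scale b q) = coker_scale (a * b) q.
Proof. by rewrite -[q]coker_reprK !coker_pi_scale scalerA. Qed.

Fact coker_scale1 : left_id 1 coker_scale.
Proof. by move=> q; rewrite -[q]coker_reprK coker_pi_scale scale1r. Qed.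

Fact coker_scaleDr : right_distributive coker_scale +%R.
Proof.
move=> a p q; rewrite -[p]coker_reprK -[q]coker_reprK.
by rewrite -coker_piD !coker_pi_scale -coker_piD scalerDr.
Qed.

Fact coker_scaleDl q : {morph coker_scale^~ q : a b / a + b}.
Proof.
by move=> a b; rewrite -[q]coker_reprK !coker_pi_scale -coker_piD scalerDl.
Qed.

HB.instance Definition _ := GRing.Zmodule_isLmodule.Build R coker
  coker_scaleA coker_scale1 coker_scaleDr coker_scaleDl.

End Coker.

(* Elements of the left module R^n are row vectors, so [row_map mu] is the
   homomorphism R^n -> R^k sending the j-th basis vector to the j-th row of the
   n x k matrix [mu].  In particular, for an n x k matrix [mu] acting as
   X^k -> X^n this is mu^t, and for the k x n matrix (r_ij) of a homomorphism
   R^n -> R^k of left modules given by its columns it is [row_map r^T]. *)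
Definition row_map (R : pzRingType) (n k : nat) (mu : 'M[R]_(n, k)) :
  {linear 'rV[R]_n -> 'rV[R]_k} := mulmxr mu.

Record presentation (R : pzRingType) (U : lmodType R) := Presentation {
  pres_gens : nat;
  pres_rels : nat;
  pres_mx : 'M[R]_(pres_rels, pres_gens);
  pres_iso : lmod_iso (coker (row_map pres_mx)) U
}.

Definition finitely_presented (R : pzRingType) (U : lmodType R) : Prop :=
  inhabited (presentation U).

Section ColumnMap.
Variables (R : pzRingType) (n k : nat) (mu : 'M[R]_(n, k)).

(* Left multiplication of columns, where the product is that of R (and not of
   R^c); it is linear for the right R-module structures. *)
Definition col_map (x : 'cV[R^c]_k) : 'cV[R^c]_n := mu *m (x : 'cV[R]_k).

Fact col_map_linear : linear col_map.
Proof.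
move=> a x y; apply/matrixP=> i j.
have colE z : col_map z i j = \sum_l mu i l * (z l j : R) by rewrite mxE.
have -> : (a *: col_map x + col_map y) i j
    = (col_map x i j : R) * (a : R) + col_map y i j by rewrite !mxE.
rewrite !colE mulr_suml -big_split /=; apply: eq_bigr => l _.
have -> : (a *: x + y) l j = (x l j : R) * (a : R) + y l j by rewrite !mxE.
by rewrite mulrDr mulrA.
Qed.

HB.instance Definition _ := GRing.isLinear.Build R^c _ _ _ col_map col_map_linear.

End ColumnMap.

(* The Auslander transpose attached to a presentation of U. *)
Definition transpose (R : pzRingType) (U : lmodType R) (p : presentation U) :
  lmodType R^c :=
  coker (col_map (pres_mx p) :
    {linear 'cV[R^c]_(pres_gens p) -> 'cV[R^c]_(pres_rels p)}).

Section Tensor.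
Variables (R : pzRingType) (M : lmodType R^c).

Section Def.
Variable N : lmodType R.

Definition free_tensor : Type := {freeg (M * N)%type / int}.
HB.instance Definition _ := GRing.Lmodule.on free_tensor.

Definition free_pure (m : M) (n : N) : free_tensor := << (m, n) >>.

Inductive tensor_rel : free_tensor -> Prop :=
| tensor_rel0 : tensor_rel 0
| tensor_relB x y of tensor_rel x & tensor_rel y : tensor_rel (x - y)
| tensor_relDl m m' n :
    tensor_rel (free_pure (m + m') n - (free_pure m n + free_pure m' n))
| tensor_relDr m n n' :
    tensor_rel (free_pure m (n + n') - (free_pure m n + free_pure m n'))
| tensor_relM m (r : R) n :
    tensor_rel (free_pure ((r : R^c) *: m) n - free_pure m (r *: n)).

Definition tensor_pred : {pred free_tensor} := fun x => `[< tensor_rel x >].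

Fact tensor_pred_zmod_closed : zmod_closed tensor_pred.
Proof.
split; first by apply/asboolP; exact: tensor_rel0.
by move=> x y /asboolP xP /asboolP yP; apply/asboolP; exact: tensor_relB.
Qed.

HB.instance Definition _ :=
  GRing.isZmodClosed.Build free_tensor tensor_pred tensor_pred_zmod_closed.

Definition tensor : Type := Quotient.quot tensor_pred.
HB.instance Definition _ := Choice.on tensor.
HB.instance Definition _ := GRing.Zmodule.on tensor.

Definition tensor_pi (x : free_tensor) : tensor :=
  \pi_(Quotient.quot tensor_pred) x.
Definition tensor_repr (t : tensor) : free_tensor :=
  repr (t : Quotient.quot tensor_pred).

Definition pure_tensor (m : M) (n : N) : tensor := tensor_pi (free_pure m n).

Lemma tensor_reprK t : tensor_pi (tensor_repr t) = t.
Proof. exact: reprK. Qed.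

Lemma tensor_pi_eq x y : tensor_pi x = tensor_pi y <-> tensor_rel (x - y).
Proof.
split=> [/eqP|/asboolP xy].
  by rewrite -(Quotient.idealrBE tensor_pred) => /asboolP.
by apply/eqP; rewrite -(Quotient.idealrBE tensor_pred).
Qed.

Lemma tensor_piB x y : tensor_pi (x - y) = tensor_pi x - tensor_pi y.
Proof. exact: raddfB. Qed.

End Def.

Section Map.
Variables (N N' : lmodType R) (f : {linear N -> N'}).

Definition free_map : free_tensor N -> free_tensor N' :=
  fglift (fun mn : (M * N)%type => free_pure mn.1 (f mn.2)).

Definition tensor_map (t : tensor N) : tensor N' :=
  tensor_pi (free_map (tensor_repr t)).

Lemma free_mapB x y : free_map (x - y) = free_map x - free_map y.
Proof. exact: lift_is_additive. Qed.

Lemma free_mapE m n : free_map (free_pure m n) = free_pure m (f n).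
Proof. by rewrite /free_map liftU scale1r. Qed.

Lemma free_map_rel x : tensor_rel x -> tensor_rel (free_map x).
Proof.
have f0 : free_map 0 = 0 by rewrite -(subrr 0) free_mapB subrr.
have fN y : free_map (- y) = - free_map y by rewrite -sub0r free_mapB f0 sub0r.
have fD y z : free_map (y + z) = free_map y + free_map z.
  by rewrite -{1}[z]opprK free_mapB fN opprK.
elim=> [|{}x y _ xP _ yP|m m' n|m n n'|m r n].
- rewrite f0; exact: tensor_rel0.
- rewrite free_mapB; exact: tensor_relB.
- rewrite free_mapB fD !free_mapE; exact: tensor_relDl.
- rewrite free_mapB fD !free_mapE linearD; exact: tensor_relDr.
- rewrite free_mapB !free_mapE linearZ_LR; exact: tensor_relM.
Qed.

Lemma tensor_map_pi x : tensor_map (tensor_pi x) = tensor_pi (free_map x).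
Proof.
apply/tensor_pi_eq; rewrite -free_mapB; apply: free_map_rel.
by apply/tensor_pi_eq; rewrite tensor_reprK.
Qed.

Lemma tensor_mapE m n : tensor_map (pure_tensor m n) = pure_tensor m (f n).
Proof. by rewrite tensor_map_pi free_mapE. Qed.

Fact tensor_map_zmod_morphism : zmod_morphism tensor_map.
Proof.
move=> s t; rewrite -[s]tensor_reprK -[t]tensor_reprK -tensor_piB.
by rewrite !tensor_map_pi free_mapB tensor_piB.
Qed.

HB.instance Definition _ :=
  GRing.isZmodMorphism.Build _ _ tensor_map tensor_map_zmod_morphism.

End Map.
End Tensor.

Definition tensor_exact (R : pzRingType) (T : lmodType R^c)
    (A B C : lmodType R) (i : {linear A -> B}) (psi : {linear B -> C}) : Prop :=
  short_exact (tensor_map (M := T) i) (tensor_map (M := T) psi).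

Definition mx_act (R : pzRingType) (X : lmodType R) (n k : nat)
    (mu : 'M[R]_(n, k)) (x : {ffun 'I_k -> X}) : {ffun 'I_n -> X} :=
  [ffun j => \sum_i mu j i *: x i].

(* A^n as a subset of B^n, for a subset A of B. *)
Definition power_set (B : Type) (A : {pred B}) (n : nat) :
  set {ffun 'I_n -> B} := [set x | forall i, x i \in A]%classic.
Arguments power_set {B} A n.

Definition soluble (R : pzRingType) (X : lmodType R) (k n : nat)
    (r : 'M[R]_(k, n)) (a : 'I_n -> X) : Prop :=
  exists x : 'I_k -> X, forall j, \sum_i r i j *: x i = a j.

(* Main.v *)
(* Let mu be the relation matrix (n x k) of a presentation of U. All four
   conditions reduce to: if a in A^n lies in mu(B^k), then a lies in mu(A^k).
   Transpose: tr(U) (x) X is X^n / mu(X^k), naturally in X, so tr(U) (x) E is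
   always right exact, and injectivity at A is the condition above.
   Purity: a map U -> C is a tuple c in C^k with mu(c) = 0. A lift b in B^k of c
   has mu(b) in A^n, and it can be corrected to a lift killed by mu exactly when
   mu(b) lies in mu(A^k). Purity depends only on U up to isomorphism, so the
   condition does not depend on the presentation. *)

Require Import Defs.
From HB Require Import structures.
From mathcomp Require Import all_boot all_order all_algebra.
From mathcomp Require Import boolp classical_sets.
From mathcomp.multinomials Require Import freeg.

Set Implicit Arguments.
Unset Strict Implicit.
Unset Printing Implicit Defensive.

Import GRing.Theory.
Local Open Scope ring_scope.
Local Open Scope classical_set_scope.

(** * Linear maps out of cokernels and free modules *)

Fact coker_pi_linear (R : pzRingType) (M N : lmodType R)
    (f : {linear M -> N}) : linear (coker_pi f).
Proof.
move=> a x y; have -> : a *: coker_pi f x = coker_pi f (a *: x).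
  exact: coker_pi_scale.
by rewrite coker_piD.
Qed.

HB.instance Definition _ (R : pzRingType) (M N : lmodType R)
    (f : {linear M -> N}) :=
  GRing.isLinear.Build R _ _ _ (coker_pi f) (coker_pi_linear f).

Lemma coker_factor (R : pzRingType) (M N P : lmodType R)
    (f : {linear M -> N}) (g : {linear N -> P}) :
  (forall x, g (f x) = 0) ->
  exists h : {linear coker f -> P}, forall y, h (coker_pi f y) = g y.
Proof.
move=> gf0; pose h (q : coker f) : P := g (coker_repr q).
have hE y : h (coker_pi f y) = g y.
  have /coker_pi_eq[x fx] := coker_reprK (coker_pi f y).
  by apply/eqP; rewrite -subr_eq0 -linearB -fx gf0.
have h_lin : linear h.
  move=> a p q; rewrite -[p]coker_reprK -[q]coker_reprK.
  by rewrite -linearP !hE linearP.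
pose hL := GRing.isLinear.Build R _ _ _ h h_lin.
by exists (HB.pack_for {linear coker f -> P} h hL).
Qed.

Lemma row_hom (R : pzRingType) (X : lmodType R) (k : nat)
    (b : {ffun 'I_k -> X}) :
  exists g : {linear 'rV[R]_k -> X}, forall v, g v = \sum_i v 0 i *: b i.
Proof.
pose g (v : 'rV[R]_k) := \sum_i v 0 i *: b i.
have g_lin : linear g.
  move=> a u v; rewrite /g scaler_sumr -big_split; apply: eq_bigr => i _ /=.
  by rewrite !mxE scalerDl scalerA.
pose gL := GRing.isLinear.Build R _ _ _ g g_lin.
by exists (HB.pack_for {linear 'rV[R]_k -> X} g gL).
Qed.

Lemma lmod_iso_inverse (R : pzRingType) (U V : lmodType R) :
  lmod_iso U V ->
  exists (f : {linear U -> V}) (f' : {linear V -> U}),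
    cancel f f' /\ cancel f' f.
Proof.
move=> [f [f' fK f'K]]; have f'_lin : linear f' := can2_linear fK f'K.
pose f'L := GRing.isLinear.Build R _ _ _ f' f'_lin.
by exists f, (HB.pack_for {linear V -> U} f' f'L).
Qed.

(** * Matrices acting on powers of a module *)

Section MatrixAction.
Variables (R : pzRingType) (n k : nat) (mu : 'M[R]_(n, k)).

Fact mx_act_zmod_morphism (X : lmodType R) : zmod_morphism (mx_act (X := X) mu).
Proof.
move=> x y; apply/ffunP => j; rewrite !ffunE -sumrB.
by apply: eq_bigr => i _; rewrite !ffunE scalerBr.
Qed.

HB.instance Definition _ (X : lmodType R) :=
  GRing.isZmodMorphism.Build _ _ (mx_act (X := X) mu)
    (@mx_act_zmod_morphism X).

Lemma mx_act_map (X Y : lmodType R) (f : {linear X -> Y})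
    (x : {ffun 'I_k -> X}) :
  mx_act mu [ffun i => f (x i)] = [ffun j => f (mx_act mu x j)].
Proof.
apply/ffunP => j; rewrite !ffunE linear_sum.
by apply: eq_bigr => i _; rewrite ffunE linearZ_LR.
Qed.

(** Associativity of the product w mu b. It shows that the map on R^k given by a tuple b kills the
    image of [row_map mu] once mu(b) vanishes. *)
Lemma row_map_act (X : lmodType R) (b : {ffun 'I_k -> X}) (w : 'rV[R]_n) :
  \sum_i row_map mu w 0 i *: b i = \sum_j w 0 j *: mx_act mu b j.
Proof.
transitivity (\sum_i \sum_j (w 0 j * mu j i) *: b i).
  by apply: eq_bigr => i _; rewrite mxE scaler_suml.
rewrite exchange_big; apply: eq_bigr => j _.
by rewrite ffunE scaler_sumr; apply: eq_bigr => i _; rewrite scalerA.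
Qed.

End MatrixAction.

(** * Lifting maps from a cokernel versus solving equations in A *)

Definition lifts (R : pzRingType) (B C : lmodType R) (psi : {linear B -> C})
    (U : lmodType R) : Prop :=
  forall g : {linear U -> C}, exists h : {linear U -> B}, psi \o h =1 g.

(** Since [i] will be injective, this is injectivity of A^n / mu(A^k) -> B^n / mu(B^k), phrased
    without quotients. *)
Definition reflects_solubility (R : pzRingType) (A B : lmodType R)
    (i : {linear A -> B}) (n k : nat) (mu : 'M[R]_(n, k)) : Prop :=
  forall (a : {ffun 'I_n -> A}) y, mx_act mu y = [ffun j => i (a j)] ->
  exists x, mx_act mu x = a.

Lemma lifts_iso (R : pzRingType) (B C : lmodType R) (psi : {linear B -> C})
    (U V : lmodType R) :
  lmod_iso U V -> lifts psi U <-> lifts psi V.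
Proof.
move=> /lmod_iso_inverse[e [e' [eK e'K]]].
split=> lift g; [have [h hE] := lift (g \o e)|have [h hE] := lift (g \o e')].
- by exists (h \o e') => v; have /= := hE (e' v); rewrite e'K.
- by exists (h \o e) => u; have /= := hE (e u); rewrite eK.
Qed.

Lemma coker_row_gens (R : pzRingType) (n k : nat) (mu : 'M[R]_(n, k)) v :
  coker_pi (row_map mu) v = \sum_l v 0 l *: coker_pi (row_map mu) 'e_l.
Proof.
rewrite [v in LHS]row_sum_delta linear_sum.
by apply: eq_bigr => l _; rewrite linearZ_LR.
Qed.

(** The rows of mu are the relations among the generators of the cokernel, and [h] preserves
    them. *)
Lemma mx_act_coker (R : pzRingType) (X : lmodType R) (n k : nat)
    (mu : 'M[R]_(n, k)) (h : {linear coker (row_map mu) -> X}) :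
  mx_act mu [ffun l => h (coker_pi (row_map mu) 'e_l)] = 0.
Proof.
apply/ffunP => j; rewrite !ffunE -[RHS](linear0 h).
transitivity (h (coker_pi (row_map mu) (row j mu))).
  rewrite coker_row_gens linear_sum.
  by apply: eq_bigr => l _; rewrite ffunE mxE linearZ_LR.
congr (h _); rewrite -[RHS](linear0 (coker_pi (row_map mu))).
by apply/coker_pi_eq; exists 'e_j; rewrite subr0 rowE.
Qed.

Section ShortExact.
Variables (R : pzRingType) (A B C : lmodType R).
Variables (i : {linear A -> B}) (psi : {linear B -> C}).
Hypothesis E : short_exact i psi.

Lemma short_exact_ffun0 n (b : {ffun 'I_n -> B}) :
  [ffun j => psi (b j)] = 0 -> exists a : {ffun 'I_n -> A},
  b = [ffun j => i (a j)].
Proof.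
case: E => _ ker_psi _ /ffunP b0.
have /choice[a aE] j : exists a, i a = b j.
  by apply/ker_psi; have := b0 j; rewrite !ffunE.
by exists (finfun a); apply/ffunP => j; rewrite !ffunE aE.
Qed.

Lemma short_exact_ffun_surj n (c : {ffun 'I_n -> C}) :
  exists b : {ffun 'I_n -> B}, [ffun j => psi (b j)] = c.
Proof.
case: E => _ _ psi_surj; have /choice[b bE] j := psi_surj (c j).
by exists (finfun b); apply/ffunP => j; rewrite !ffunE bE.
Qed.

Variables (n k : nat) (mu : 'M[R]_(n, k)).

Lemma lifts_reflects_solubility :
  lifts psi (coker (row_map mu)) <-> reflects_solubility i mu.
Proof.
have [i_inj ker_psi _] := E.
have psi_i a : psi (i a) = 0 by apply/ker_psi; exists a.
split=> [lift a y muy|refl g].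
(* Modulo A, y solves the homogeneous system, because mu(y) has entries in A. So psi(y) defines a
   map from the cokernel to C. *)
- have [g0 g0E] := row_hom [ffun l => psi (y l)].
  have g0mu w : g0 (row_map mu w) = 0.
    rewrite g0E row_map_act mx_act_map muy big1 // => j _.
    by rewrite !ffunE psi_i scaler0.
  have [g gE] := coker_factor g0mu.
  have [h hE] := lift g.
  (* Both y and the tuple of the lift [h] lie over psi(y), so [x0] comes from A; the tuple of [h] is
     killed by mu, so mu(x0) = mu(y). *)
  pose x0 := y - [ffun l => h (coker_pi (row_map mu) 'e_l)].
  have [|x x0E] := @short_exact_ffun0 _ x0.
    apply/ffunP => l; rewrite !ffunE linearB.
    have /= -> := hE (coker_pi (row_map mu) 'e_l).
    rewrite gE g0E (bigD1 l) //= !mxE !eqxx scale1r ffunE big1 ?addr0 ?subrr //.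
    by move=> m /negPf ml; rewrite mxE ml scale0r.
  exists x; apply/ffunP => j; apply: i_inj.
  have /ffunP/(_ j) : mx_act mu x0 = [ffun j => i (a j)].
    by rewrite raddfB /= mx_act_coker subr0.
  by rewrite x0E mx_act_map !ffunE.
- have [b bE] :=
    short_exact_ffun_surj [ffun l => g (coker_pi (row_map mu) 'e_l)].
  have [a aE] : exists a : {ffun 'I_n -> A}, mx_act mu b = [ffun j => i (a j)].
    by apply: short_exact_ffun0; rewrite -mx_act_map bE mx_act_coker.
  (* Subtracting i(x) from b leaves psi(b) unchanged and makes mu vanish, so the corrected tuple
     factors through the cokernel. *)
  have [x muxE] := refl _ _ aE.
  have [h0 h0E] := row_hom (b - [ffun l => i (x l)]).
  have h0mu w : h0 (row_map mu w) = 0.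
    rewrite h0E row_map_act raddfB /= mx_act_map muxE aE subrr.
    by rewrite big1 // => j _; rewrite ffunE scaler0.
  have [h hE] := coker_factor h0mu.
  exists h => q /=; rewrite -[q]coker_reprK; set v := coker_repr q.
  rewrite hE h0E linear_sum coker_row_gens linear_sum; apply: eq_bigr => l _.
  rewrite !linearZ_LR !ffunE linearB psi_i subr0; congr (_ *: _).
  by have /ffunP/(_ l) := bE; rewrite !ffunE.
Qed.

End ShortExact.

(** * Tensor products: bilinearity, generation, maps out of the free group *)

Section TensorTheory.
Variables (R : pzRingType) (M : lmodType R^c) (X : lmodType R).

Lemma tensor_piD (z w : free_tensor M X) :
  tensor_pi (z + w) = tensor_pi z + tensor_pi w.
Proof. exact: raddfD. Qed.

Lemma pure_tensorDl (m m' : M) (x : X) :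
  pure_tensor (m + m') x = pure_tensor m x + pure_tensor m' x.
Proof. by rewrite -tensor_piD; apply/tensor_pi_eq; apply: tensor_relDl. Qed.

Lemma pure_tensorDr (m : M) (x x' : X) :
  pure_tensor m (x + x') = pure_tensor m x + pure_tensor m x'.
Proof. by rewrite -tensor_piD; apply/tensor_pi_eq; apply: tensor_relDr. Qed.

Lemma pure_tensorM (m : M) (r : R) (x : X) :
  pure_tensor ((r : R^c) *: m) x = pure_tensor m (r *: x).
Proof. by apply/tensor_pi_eq; apply: tensor_relM. Qed.

Lemma pure_tensor0l (x : X) : pure_tensor (0 : M) x = 0.
Proof. by apply: (addrI (pure_tensor 0 x)); rewrite -pure_tensorDl !addr0. Qed.

Fact pure_tensor_zmod_morphism (m : M) :
  zmod_morphism (pure_tensor m : X -> tensor M X).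
Proof.
by move=> x y; apply: (addIr (pure_tensor m y)); rewrite -pure_tensorDr !subrK.
Qed.

HB.instance Definition _ (m : M) :=
  GRing.isZmodMorphism.Build X (tensor M X) (pure_tensor m)
    (pure_tensor_zmod_morphism m).

Lemma pure_tensor_suml (I : finType) (m : I -> M) (x : X) :
  pure_tensor (\sum_j m j) x = \sum_j pure_tensor (m j) x.
Proof.
exact: (big_morph (fun m => pure_tensor m x)
  (fun m m' => pure_tensorDl m m' x) (pure_tensor0l x)).
Qed.

Lemma tensor_span (P : tensor M X -> Prop) :
  P 0 -> (forall s t, P s -> P t -> P (s - t)) ->
  (forall m x, P (pure_tensor m x)) -> forall t, P t.
Proof.
move=> P0 PB Ppure t.
have PN s : P s -> P (- s) by move=> Ps; rewrite -sub0r; apply: PB.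
have PD s s' : P s -> P s' -> P (s + s').
  by move=> Ps Ps'; rewrite -[s']opprK; apply/PB/PN.
have Pn s l : P s -> P (s *+ l).
  by move=> Ps; elim: l => [|l IHl] //; rewrite mulrS; apply: PD.
rewrite -[t]tensor_reprK.
elim/freeg_ind_dom0: (tensor_repr t) => [|l mx z _ _ Pz].
  by have -> : tensor_pi 0 = 0 :> tensor M X by exact: raddf0.
case: mx => m x; rewrite tensor_piD; apply: PD => //.
(* An integer coefficient is an iterated sum or its negative, so closure under differences
   suffices. *)
have -> : tensor_pi << l *g (m, x) >> = pure_tensor m x *~ l :> tensor M X.
  rewrite -[l in LHS]intz -freeg_mulz.
  exact: (raddfMz (tensor_pi (M := M) (N := X))).
by case: l => l; [|apply: PN]; apply: Pn.
Qed.

Lemma free_tensor_lift (V : zmodType) (F : M -> X -> V) :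
  exists G : {additive free_tensor M X -> V},
    forall m x, G (free_pure m x) = F m x.
Proof.
(* [zmodule V] regards the abelian group as a module over the integers, the coefficients of the free
   group. *)
pose G : free_tensor M X -> V :=
  @fglift int (zmodule V) _ (fun mx : M * X => F mx.1 mx.2).
have G_additive : zmod_morphism G.
  by move=> z w; exact: (@lift_is_additive int _ (zmodule V) _ z w).
pose GM := GRing.isZmodMorphism.Build _ _ G G_additive.
exists (HB.pack_for {additive free_tensor M X -> V} G GM) => m x /=.
by rewrite /G /free_pure liftU scale1r.
Qed.

End TensorTheory.

(** * Tensoring with the cokernel of a column map *)

Section TensorCokernel.
Variables (R : pzRingType) (n k : nat) (mu : 'M[R]_(n, k)).

Local Notation cmap := (col_map mu : {linear 'cV[R^c]_k -> 'cV[R^c]_n}).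
Let T : lmodType R^c := coker cmap.
Let e (j : 'I_n) : T := coker_pi cmap (delta_mx j 0).

(** The map X^n -> T (x) X that will induce the isomorphism from X^n / mu(X^k). *)
Definition tensor_gens (X : lmodType R) (x : {ffun 'I_n -> X}) : tensor T X :=
  \sum_j pure_tensor (e j) (x j).

Fact tensor_gens_zmod_morphism (X : lmodType R) :
  zmod_morphism (@tensor_gens X).
Proof.
move=> x y; rewrite /tensor_gens -sumrB.
by apply: eq_bigr => j _; rewrite !ffunE raddfB.
Qed.

HB.instance Definition _ (X : lmodType R) :=
  GRing.isZmodMorphism.Build _ _ (@tensor_gens X)
    (@tensor_gens_zmod_morphism X).

Lemma tensor_map_gens (X Y : lmodType R) (f : {linear X -> Y})
    (x : {ffun 'I_n -> X}) :
  tensor_map f (tensor_gens x) = tensor_gens [ffun j => f (x j)].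
Proof.
rewrite raddf_sum; apply: eq_bigr => j _.
by rewrite ffunE /= tensor_mapE.
Qed.

(** Expand v in the standard basis and move each coordinate across the tensor sign. *)
Lemma pure_tensor_gens (X : lmodType R) (v : 'cV[R^c]_n) (x : X) :
  pure_tensor (coker_pi cmap v : T) x
    = tensor_gens [ffun j => (v j 0 : R) *: x].
Proof.
have vE : v = \sum_j v j 0 *: delta_mx j 0.
  by rewrite [LHS]matrix_sum_delta; apply: eq_bigr => j _; rewrite big_ord1.
rewrite [v in LHS]vE linear_sum pure_tensor_suml; apply: eq_bigr => j _.
by rewrite ffunE linearZ_LR -pure_tensorM.
Qed.

Lemma tensor_gens_surj (X : lmodType R) (t : tensor T X) :
  exists x, tensor_gens x = t.
Proof.
elim/tensor_span: t => [|_ _ [x <-] [y <-]|m x].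
- by exists 0; rewrite raddf0.
- by exists (x - y); rewrite raddfB.
- by rewrite -[m]coker_reprK pure_tensor_gens; eexists.
Qed.

Lemma tensor_gens_eq0 (X : lmodType R) (x : {ffun 'I_n -> X}) :
  tensor_gens x = 0 <-> exists y, mx_act mu y = x.
Proof.
split=> [gx0|[y <-]]; last first.
  (* Regroup by columns: mu(y) goes to the sum of (i-th column of mu) (x) y_i, and every column of
     mu is zero in T. *)
  transitivity (\sum_i
      pure_tensor (coker_pi cmap (col_map mu (delta_mx i 0)) : T) (y i)).
    under eq_bigr do rewrite pure_tensor_gens.
    rewrite -raddf_sum; congr tensor_gens; apply/ffunP => j.
    rewrite sum_ffunE ffunE; apply: eq_bigr => i _; rewrite ffunE.
    by congr (_ *: _); rewrite -[col_map _ _]/(mu *m _) -colE mxE.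
  rewrite big1 // => i _.
  have -> : coker_pi cmap (col_map mu (delta_mx i 0)) = 0 :> T.
    rewrite -[RHS](linear0 (coker_pi cmap)); apply/coker_pi_eq.
    by exists (delta_mx i 0); rewrite subr0.
  exact: pure_tensor0l.
(* G induces the inverse T (x) X -> X^n / mu X^k of tensor_gens. *)
have [G GE] := free_tensor_lift
  (fun (m : T) (z : X) => [ffun j => (coker_repr m j 0 : R) *: z]).
(* [G] depends on chosen representatives, but another choice changes its values only by elements of
   mu(X^k). *)
have im_repr (v w : 'cV[R^c]_n) (z : X) :
    coker_pi cmap v = coker_pi cmap w ->
    exists y, mx_act mu y = [ffun j => (v j 0 : R) *: z - (w j 0 : R) *: z].
  move=> /coker_pi_eq[u uE]; exists [ffun i => (u i 0 : R) *: z].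
  apply/ffunP => j; rewrite !ffunE -scalerBl.
  have -> : (v j 0 : R) - w j 0 = \sum_i mu j i * (u i 0 : R).
    by transitivity ((v - w) j 0); [rewrite !mxE | rewrite -uE mxE].
  by rewrite scaler_suml; apply: eq_bigr => i _; rewrite ffunE scalerA.
(* Additivity in X holds exactly under [G]; additivity in T and the scalar relation hold modulo
   mu(X^k), by [im_repr]. *)
have im_rel z : tensor_rel z -> exists y, mx_act mu y = G z.
  elim=> [|z1 z2 _ [y1 y1E] _ [y2 y2E]|m m' z0|m z0 z0'|m r z0].
  - by exists 0; rewrite !raddf0.
  - by exists (y1 - y2); rewrite !raddfB /= y1E y2E.
  - have [|y yE] := im_repr (coker_repr (m + m'))
      (coker_repr m + coker_repr m') z0.
      by rewrite coker_piD !coker_reprK.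
    exists y; rewrite yE raddfB raddfD !GE; apply/ffunP => j.
    by rewrite !ffunE mxE scalerDl.
  - exists 0; rewrite raddf0 raddfB raddfD !GE; apply/ffunP => j.
    by rewrite !ffunE scalerDr subrr.
  - have [|y yE] := im_repr (coker_repr ((r : R^c) *: m))
      ((r : R^c) *: coker_repr m) z0.
      by rewrite coker_reprK linearZ_LR /= coker_reprK.
    exists y; rewrite yE raddfB !GE; apply/ffunP => j.
    by rewrite !ffunE mxE scalerA.
have [y yE] : exists y, mx_act mu y = G (\sum_j free_pure (e j) (x j)).
  apply: im_rel; rewrite -[X in tensor_rel X]subr0; apply/tensor_pi_eq.
  transitivity (tensor_gens x); first exact: raddf_sum.
  by rewrite gx0; apply/esym; exact: raddf0.
(* The chosen representative of [e j] need not be the basis vector, so [G] returns x only up to the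
   elements mu(y'_j). *)
have /choice[y' y'E] j := im_repr _ _ (x j) (coker_reprK (e j)).
exists (y - \sum_j y' j); rewrite raddfB raddf_sum /= yE raddf_sum -sumrB.
apply/ffunP => i; rewrite sum_ffunE (bigD1 i) //= big1 => [|j /negPf ji].
  by rewrite addr0 y'E GE !ffunE mxE !eqxx subKr scale1r.
by rewrite y'E GE !ffunE mxE eq_sym ji subKr scale0r.
Qed.

End TensorCokernel.

(** Everything is computed on tuples through [tensor_gens]; [refl] enters only for injectivity, the
    rest being right exactness. *)
Lemma transpose_reflects_solubility (R : pzRingType) (A B C : lmodType R)
    (i : {linear A -> B}) (psi : {linear B -> C}) (U : lmodType R)
    (p : presentation U) :
  short_exact i psi ->
  tensor_exact (transpose p) i psi <-> reflects_solubility i (pres_mx p).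
Proof.
move=> E; have [_ ker_psi _] := E; set mu := pres_mx p.
have psi_i a : psi (i a) = 0 by apply/ker_psi; exists a.
split=> [[tens_inj _ _] a y muy|refl].
  apply/tensor_gens_eq0/tens_inj; rewrite raddf0 /= tensor_map_gens.
  by apply/tensor_gens_eq0; exists y.
split.
- apply: raddf_inj => t; have [a <-] := tensor_gens_surj t.
  rewrite /= tensor_map_gens => /tensor_gens_eq0[y muy].
  by apply/tensor_gens_eq0/(refl _ y).
- move=> t; split=> [|[s <-]]; last first.
    have [a <-] := tensor_gens_surj s.
    rewrite !tensor_map_gens -[RHS](raddf0 (@tensor_gens _ _ _ mu C)).
    by congr tensor_gens; apply/ffunP => j; rewrite !ffunE psi_i.
  have [b <-] := tensor_gens_surj t.
  rewrite /= tensor_map_gens => /tensor_gens_eq0[c muc].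
  (* From psi(b) = mu(c), lift c to b'. Then b - mu(b') lies over 0, hence in A^n, and represents
     the same tensor as b. *)
  have [b' b'E] := short_exact_ffun_surj E c.
  have [|a aE] := short_exact_ffun0 E (b := b - mx_act mu b').
    apply/ffunP => j; have /ffunP/(_ j) := muc.
    by rewrite -b'E mx_act_map !ffunE linearB => ->; rewrite subrr.
  exists (tensor_gens mu a); rewrite tensor_map_gens -aE raddfB /=.
  have -> : tensor_gens mu (mx_act mu b') = 0.
    by apply/tensor_gens_eq0; exists b'.
  by rewrite subr0.
- move=> t; have [c <-] := tensor_gens_surj t.
  have [b <-] := short_exact_ffun_surj E c.
  by exists (tensor_gens mu b); rewrite tensor_map_gens.
Qed.

(** * The equivalence of the four conditions *)

Lemma power_set_inclusion (R : pzRingType) (B : lmodType R) (inA : {pred B})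
    (A : subLmodType inA) (n : nat) (x : {ffun 'I_n -> B}) :
  power_set inA n x <->
  exists a : {ffun 'I_n -> A}, x = [ffun j => inclusion A (a j)].
Proof.
split=> [xA|[a ->] j]; last by rewrite ffunE; exact: (valP (a j)).
exists [ffun j => Sub (x j) (xA j) : A]; apply/ffunP => j.
by rewrite !ffunE /inclusion /= SubK.
Qed.

(* [pres] chooses, for each finitely presented module, the presentation from
   which its transpose is formed; it is arbitrary. *)
Theorem proposition2p4 (R : pzRingType) (S : lmodType R -> Prop)
    (S_fp : forall U, S U -> finitely_presented U)
    (pres : forall U : lmodType R, finitely_presented U -> presentation U)
    (B C : lmodType R) (inA : {pred B}) (A : subLmodType inA)
    (psi : {linear B -> C})
    (E_exact : short_exact (inclusion A) psi) :
  [<->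
    pure_exact S (inclusion A) psi;
    forall U (SU : S U), tensor_exact (transpose (pres U (S_fp U SU)))
      (inclusion A) psi;
    forall (k n : nat) (mu : 'M[R]_(n, k)),
      iso_to_member S (coker (row_map mu)) ->
      mx_act mu @` power_set inA k
        = power_set inA n `&` (mx_act mu @` [set: {ffun 'I_k -> B}]);
    forall (k n : nat) (r : 'M[R]_(k, n)),
      iso_to_member S (coker (row_map r^T)) ->
      forall a : 'I_n -> A,
        soluble r (fun j => inclusion A (a j)) -> soluble r a ].
Proof.
have lifts_pres U (p : presentation U) : lifts psi U <->
    reflects_solubility (inclusion A) (pres_mx p).
  exact: (iff_trans (iff_sym (lifts_iso psi (pres_iso p)))
            (lifts_reflects_solubility E_exact _)).
tfae.
- move=> [_ pureS] U SU; apply/(transpose_reflects_solubility _ E_exact).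
  exact/lifts_pres/pureS.
- move=> tensS k n mu [V SV muV].
  have refl : reflects_solubility (inclusion A) mu.
    (* The matrix chosen by [pres] for V may differ from mu; passing through [lifts], which is
       invariant under isomorphism, exchanges them. *)
    apply/(lifts_reflects_solubility E_exact)/(lifts_iso psi muV).
    exact/lifts_pres/(transpose_reflects_solubility _ E_exact)/(tensS V SV).
  apply/seteqP; split=> [_ [x /(power_set_inclusion A)[x' ->] <-]|].
    split; last by exists [ffun l => inclusion A (x' l)].
    by apply/(power_set_inclusion A); exists (mx_act mu x'); rewrite mx_act_map.
  move=> _ [/(power_set_inclusion A)[a ->] [y _ muy]].
  have [x <-] := refl a y muy.
  exists [ffun l => inclusion A (x l)]; last by rewrite mx_act_map.
  by apply/(power_set_inclusion A); exists x.
- move=> imS k n r rS a [y yE].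
  (* Only the inclusion of A^n meet mu(B^k) in mu(A^k) carries information about solubility. *)
  have /seteqP[_ /(_ [ffun j => inclusion A (a j)])] := imS _ _ _ rS.
  case=> [|_ /(power_set_inclusion A)[x ->]].
    split.
      apply/(power_set_inclusion A); exists (finfun a).
      by apply/ffunP => j; rewrite !ffunE.
    exists (finfun y) => //; apply/ffunP => j; rewrite !ffunE -yE.
    by apply: eq_bigr => l _; rewrite ffunE mxE.
  rewrite mx_act_map => /ffunP xE; exists x => j; apply: val_inj.
  have := xE j; rewrite !ffunE => /= <-; congr (inclusion A _).
  by apply: eq_bigr => l _; rewrite mxE.
- move=> solS; split=> // U SU.
  have [p] := S_fp U SU; apply/(lifts_pres U p) => a y muy.
  (* Presentation matrices list relations as rows, whereas (iv) has them as columns, hence the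
     transpose. *)
  have [||x xE] := solS _ _ (pres_mx p)^T _ a.
  + by rewrite trmxK; exists U => //; exact: pres_iso.
  + exists y => j; have /ffunP/(_ j) := muy; rewrite !ffunE => <-.
    by apply: eq_bigr => l _; rewrite mxE.
  exists (finfun x); apply/ffunP => j; rewrite -xE ffunE.
  by apply: eq_bigr => l _; rewrite ffunE mxE.
Qed.
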